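(* Let $(H,\mu)$ be a commutative Hilbertian Frobenius semigroup and let $J=J(H,\mu)$ be its Jacobson radical. Then $H=J\oplus_2 J^{\perp}$ (orthogonal direct sum of Hilbert spaces), $J^{\perp}$ is both a closed subalgebra and a closed subcoalgebra of $(H,\mu)$, and $J=A(H,\mu)$ is also both a closed subalgebra and a closed subcoalgebra of $(H,\mu)$. In particular, $J$ and $J^{\perp}$ are ideals of $(H,\mu)$.
   Context: All Hilbert spaces are complex; $\hat{\otimes}_2$ is the Hilbert space tensor product (completion of the algebraic tensor product for $\langle u\otimes v,u'\otimes v'\rangle=\langle u,u'\rangle\langle v,v'\rangle$); $f^{\dagger}$ is the Hilbert adjoint of a bounded linear map $f$. A Hilbertian algebra (or Hilbertian semigroup) is a pair $(H,\mu)$ with $H$ a Hilbert space and $\mu\colon H\hat{\otimes}_2H\to H$ a bounded linear map which is associative and commutative (no unit is assumed); write $xy:=\mu(x\otimes y)$. With $\alpha\colon (H\hat{\otimes}_2H)\hat{\otimes}_2H\to H\hat{\otimes}_2(H\hat{\otimes}_2H)$ the canonical unitary, $(H,\mu)$ is a (commutative) Hilbertian Frobenius semigroup when moreover $(\mu\hat{\otimes}_2 id)\circ\alpha^{-1}\circ(id\hat{\otimes}_2\mu^{\dagger})=\mu^{\dagger}\circ\mu=(id\hat{\otimes}_2\mu)\circ\alpha\circ(\mu^{\dagger}\hat{\otimes}_2 id)$. $J(H,\mu)$ denotes the Jacobson radical of the commutative Banach algebra $H$ with product $(x,y)\mapsto xy$ (and an equivalent submultiplicative norm), i.e. the intersection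 of its maximal modular ideals, equivalently of the kernels of its non-zero algebra maps to $\mathbb{C}$ (so $J(H,\mu)=H$ if there are none). The annihilator is $A(H,\mu)=\{u\in H\colon uv=0\text{ for all }v\in H\}$. A subalgebra is a closed subspace $V$ with $\mu(V\hat{\otimes}_2V)\subseteq V$; a subcoalgebra is a closed subspace $V$ with $\mu^{\dagger}(V)\subseteq V\hat{\otimes}_2V$, where $V\hat{\otimes}_2V$ is identified with its image in $H\hat{\otimes}_2H$. An ideal is a linear subspace $I$ with $xy\in I$ for all $x\in I$, $y\in H$. *)

(* Defs.v *)
From HB Require Import structures.
From mathcomp Require Export all_boot all_order all_algebra.
From mathcomp Require Export all_classical all_reals all_analysis.
From mathcomp.real_closed Require Export complex.

Set Implicit Arguments.
Unset Strict Implicit.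
Unset Printing Implicit Defensive.

Export numFieldNormedType.Exports.
Import Order.TTheory GRing.Theory Num.Theory.

Local Open Scope classical_set_scope.
Local Open Scope complex_scope.
Local Open Scope ring_scope.

(* [inner] is linear in its first argument and conjugate-linear in its second
   one. Norms over R[i] take their (real) values in R[i]. *)
HB.mixin Record CompleteNormedModule_isHilbert (R : realType) H
    of CompleteNormedModule [the numFieldType of R[i]] H := {
  inner : {dot H for @Num.conj R[i]} ;
  inner_normE : forall x : H, `|x| ^+ 2 = inner x x
}.

#[short(type="hilbertType")]
HB.structure Definition Hilbert (R : realType) :=
  {H of CompleteNormedModule_isHilbert R H
      & CompleteNormedModule [the numFieldType of R[i]] H}.

Section HilbertSpaces.
Variable R : realType.
Implicit Types H K : hilbertType R.

Definition bounded_linear H K (f : H -> K) : Prop :=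
  linear f /\ bounded_near f (nbhs (0 : H)).

Definition unitary_map H K (f : H -> K) : Prop :=
  [/\ linear f, forall x y, inner (f x) (f y) = inner x y
    & forall y, exists x, f x = y].

(* By the Riesz representation theorem there is exactly one such [z] as soon as
   [f] is bounded and linear; the default value is then never used. *)
Definition adjoint H K (f : H -> K) (y : K) : H :=
  xget 0 [set z | forall x, inner (f x) y = inner x z].

Definition subspace_set H (V : set H) : Prop := submod_closed [in V].

Definition closed_subspace H (V : set H) : Prop :=
  subspace_set V /\ closed V.

Definition linear_span H (A : set H) : set H :=
  [set x | exists n (c : 'I_n -> R[i]) (a : 'I_n -> H),
     (forall i, A (a i)) /\ x = \sum_(i < n) c i *: a i].

Definition orthocomplement H (V : set H) : set H :=
  [set x | forall y, V y -> inner x y = 0].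

Definition orthogonal_decomposition H (V W : set H) : Prop :=
  [/\ closed_subspace V, closed_subspace W,
      forall v w, V v -> W w -> inner v w = 0
    & forall x, exists v w, [/\ V v, W w & x = v + w]].

(* A completion of the algebraic tensor product of H and K: since
   <u (x) v, u' (x) v'> = <u, u'> <v, v'>, the span of the elementary tensors
   in [tensor_space] is an isometric copy of the algebraic tensor product. *)
Record hilbertTensor H K := HilbertTensor {
  tensor_space :> hilbertType R ;
  tensor : {bilinear H -> K -> tensor_space} ;
  inner_tensor : forall u u' v v',
    inner (tensor u v) (tensor u' v') = inner u u' * inner v v' ;
  dense_tensor : dense (linear_span [set tensor p.1 p.2 | p in setT])
}.

(* The image of the tensor product of V and W in that of H and K. *)
Definition tensor_subspace H K (T : hilbertTensor H K) (V : set H) (W : set K)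
    : set T :=
  closure (linear_span [set tensor T p.1 p.2 | p in V `*` W]).

(* In each of the next two definitions a map [h] always exists when [f] and [g]
   are bounded and linear, and it is unique since the span of the elementary
   tensors is dense. *)
Definition is_tensor_map H K H' K' (T : hilbertTensor H K)
    (T' : hilbertTensor H' K') (f : H -> H') (g : K -> K') (h : T -> T')
    : Prop :=
  bounded_linear h /\ forall x y, h (tensor T x y) = tensor T' (f x) (g y).

Definition is_associator H K L (HK : hilbertTensor H K)
    (HK_L : hilbertTensor HK L) (KL : hilbertTensor K L)
    (H_KL : hilbertTensor H KL) (h : HK_L -> H_KL) : Prop :=
  unitary_map h /\ forall x y z,
    h (tensor HK_L (tensor HK x y) z) = tensor H_KL x (tensor KL y z).

End HilbertSpaces.

Arguments tensor_subspace {R H K} T V W.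

Section HilbertianAlgebras.
Variables (R : realType) (H : hilbertType R) (HH : hilbertTensor H H).
Variable mu : HH -> H.

Definition product (x y : H) : H := mu (tensor HH x y).

Definition hilbertian_algebra : Prop :=
  [/\ bounded_linear mu, associative product & commutative product].

Definition frobenius_semigroup (HH_H : hilbertTensor HH H)
    (H_HH : hilbertTensor H HH) : Prop :=
  hilbertian_algebra /\
  exists (alpha : HH_H -> H_HH) (alphaV : H_HH -> HH_H)
         (mu_id : HH_H -> HH) (id_mu : H_HH -> HH)
         (comu_id : HH -> HH_H) (id_comu : HH -> H_HH),
    [/\ is_associator alpha, cancel alpha alphaV & cancel alphaV alpha] /\
    [/\ is_tensor_map mu idfun mu_id, is_tensor_map idfun mu id_mu,
        is_tensor_map (adjoint mu) idfun comu_id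
      & is_tensor_map idfun (adjoint mu) id_comu] /\
    mu_id \o alphaV \o id_comu = adjoint mu \o mu /\
    adjoint mu \o mu = id_mu \o alpha \o comu_id.

Definition is_ideal (I : set H) : Prop :=
  subspace_set I /\ forall x y, I x -> I (product x y).

Definition modular (I : set H) : Prop :=
  exists e, forall x, I (x - product e x).

Definition maximal_modular (I : set H) : Prop :=
  [/\ is_ideal I, modular I, I <> setT
    & forall K, is_ideal K -> I `<=` K -> K <> setT -> K = I].

(* All of H when there is no maximal modular ideal. *)
Definition jacobson_radical : set H :=
  \bigcap_(I in [set I | maximal_modular I]) I.

Definition annihilator : set H := [set u | forall v, product u v = 0].

Definition subalgebra (V : set H) : Prop :=
  closed_subspace V /\ mu @` tensor_subspace HH V V `<=` V.

Definition subcoalgebra (V : set H) : Prop :=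
  closed_subspace V /\ adjoint mu @` V `<=` tensor_subspace HH V V.

End HilbertianAlgebras.

(* Main.v *)
From HB Require Import structures.
Require Import Defs.
From mathcomp Require Import all_boot all_order all_algebra.
From mathcomp Require Import all_classical all_reals all_analysis.
From mathcomp Require Import ring lra.

Set Implicit Arguments.
Unset Strict Implicit.
Unset Printing Implicit Defensive.

Import Order.TTheory GRing.Theory Num.Theory.

Local Open Scope classical_set_scope.
Local Open Scope complex_scope.
Local Open Scope ring_scope.

(** Write x y for the product, M_x for the operator h |-> x h, L_x for its
    adjoint and A for the annihilator. Everything rests on one consequence of
    the Frobenius identity: taking inner products with elementary tensors, it
    says that L_x (a b) = (L_x a) b, that is, every L_x commutes with every M_b
    ([frobenius_adjoint_product]). In particular the operators M_x are normal.

    A quasi-nilpotent normal operator is zero, so the radical J should be A.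
    This is proved without the spectral radius formula
    ([jacobson_annihilator]). For x in J put z = L_x x. By the commutation,
    M_z = L_x M_x is a positive operator which is itself a multiplication
    operator, and z h = x (L_x h) lies in J for every h. Hence every multiple
    e of z has a quasi-inverse y, that is, y - e y = e
    ([jacobson_quasi_inverse], by Zorn's lemma), and then I - M_e has the
    bounded inverse I + M_y. Let c be the least constant such that
    |x h|^2 <= c |h|^2 for all h, and suppose that c > 0. For e = z / c one
    computes |h - e h|^2 <= |h|^2 - |x h|^2 / c, while
    |h|^2 <= D |h - e h|^2 because of the bounded inverse. Together these bound
    |x h|^2 by c (1 - 1/D) |h|^2, against the minimality of c. So x h = 0 for
    all h. The other inclusion is immediate, as a = a - e a lies in I whenever
    a is in A and e is an identity modulo I.

    The rest is linear algebra. By normality |L_x a| = |x a| = 0 for a in A, so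
    every product is orthogonal to A ([product_perp]); thus A^perp is an ideal,
    and the comultiplication vanishes on A ([adjoint_mu_annihilator]). For z in
    A^perp the comultiplication of z is orthogonal to the tensors of A with H
    and of H with A, hence lies in the tensor square of A^perp
    ([tensor_subspace_orth]).

    The Hilbert space theory that this uses is developed from the completeness
    of the norm: Cauchy-Schwarz, projection on closed subspaces, the Riesz
    representation theorem and the existence of adjoints. *)

(** * Real-valued norms and inner products *)

Lemma ltc0R (R : rcfType) (k : R) : (0 < k%:C) = (0 < k).
Proof. by rewrite -ltcR. Qed.

Lemma eq0_norm_le (R : realType) (a : R[i]) :
  (forall e : R, 0 < e -> `|a| <= e%:C) -> a = 0.
Proof.
move=> h; apply/eqP; rewrite -normr_eq0 eq_le normr_ge0 andbT normc_def lecR.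
by apply/ler_addgt0Pr => e e0; rewrite add0r -lecR -normc_def h.
Qed.

Lemma gt0c_real (R : rcfType) (e : R[i]) :
  0 < e -> 0 < complex.Re e /\ e = (complex.Re e)%:C.
Proof. by case: e => r i; rewrite ltcE/= => /andP[/eqP -> ?]. Qed.

Section Inner.
Variables (R : realType) (H : hilbertType R).
Implicit Types (x y z : H) (a : R[i]) (V A : set H).

(** The norm takes its values in R[i]; its real part carries the same
    information and lives in a totally ordered field. *)
Definition rnorm x : R := complex.Re `|x|.

Lemma normr_rnorm x : `|x| = (rnorm x)%:C.
Proof.
by rewrite /rnorm; apply/eqP; rewrite eq_complex/= ger0_Im ?normr_ge0// !eqxx.
Qed.

Lemma rnorm_ge0 x : 0 <= rnorm x.
Proof. by rewrite -ler0c -normr_rnorm normr_ge0. Qed.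

Lemma rnorm_inner x : inner x x = (rnorm x ^+ 2)%:C.
Proof. by rewrite -inner_normE normr_rnorm rmorphXn. Qed.

Lemma innerDl x y z : inner (x + y) z = inner x z + inner y z.
Proof. by rewrite linearDl. Qed.

Lemma innerDr x y z : inner x (y + z) = inner x y + inner x z.
Proof. by rewrite linearDr. Qed.

Lemma innerBl x y z : inner (x - y) z = inner x z - inner y z.
Proof. by rewrite linearBl. Qed.

Lemma innerBr x y z : inner x (y - z) = inner x y - inner x z.
Proof. by rewrite linearBr. Qed.

Lemma inner0l z : inner (0 : H) z = 0.
Proof. by rewrite linear0l. Qed.

Lemma inner0r z : inner z (0 : H) = 0.
Proof. by rewrite linear0r. Qed.

Lemma innerZl a x y : inner (a *: x) y = a * inner x y.
Proof. by rewrite linearZl_LR. Qed.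

Lemma innerZr a x y : inner x (a *: y) = Num.conj a * inner x y.
Proof. by rewrite linearZr_LR. Qed.

Lemma innerC x y : inner x y = Num.conj (inner y x).
Proof. by rewrite (hermC _ x y) expr0 mul1r. Qed.

Lemma rnorm0 : rnorm 0 = 0.
Proof. by rewrite /rnorm normr0. Qed.

Lemma rnorm_eq0 x : rnorm x = 0 -> x = 0.
Proof. by move=> h; apply/eqP; rewrite -normr_eq0 normr_rnorm h. Qed.

Lemma rnormD x y : rnorm (x + y) <= rnorm x + rnorm y.
Proof. by rewrite -lecR rmorphD/= -!normr_rnorm ler_normD. Qed.

Lemma rnormZ a x : rnorm (a *: x) = complex.Re `|a| * rnorm x.
Proof.
apply: complexI; rewrite rmorphM -!normr_rnorm normrZ; congr (_ * _).
by apply/eqP; rewrite eq_complex/= ger0_Im ?normr_ge0// !eqxx.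
Qed.
Lemma rnormZr (t : R) x : rnorm (t%:C *: x) = `|t| * rnorm x.
Proof. by rewrite rnormZ normc_def/= expr0n/= addr0 sqrtr_sqr. Qed.

Lemma rnormN x : rnorm (- x) = rnorm x.
Proof. by rewrite /rnorm normrN. Qed.

Lemma rnormB x y : rnorm (x - y) = rnorm (y - x).
Proof. by rewrite /rnorm distrC. Qed.

Lemma sqr_rnormD x y :
  rnorm (x + y) ^+ 2 =
  rnorm x ^+ 2 + rnorm y ^+ 2 + complex.Re (inner x y) *+ 2.
Proof.
have := rnorm_inner (x + y).
rewrite innerDl !innerDr (innerC y x) !rnorm_inner.
move=> /(congr1 (@complex.Re R)) /=.
by case: (inner x y) => r i /= <-; ring.
Qed.

Lemma inner_nondeg x : (forall y, inner y x = 0) -> x = 0.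
Proof.
move=> h; apply: rnorm_eq0; have := h x; rewrite rnorm_inner => /complexI.
by move/eqP; rewrite sqrf_eq0 => /eqP.
Qed.

End Inner.

(** * Closure, density and completeness in terms of the real norm *)

Section Topology.
Variables (R : realType) (H : hilbertType R).
Implicit Types (x y z : H) (a : R[i]) (V A : set H).

Lemma rnorm_closureP V x :
  closure V x <-> forall e : R, 0 < e -> exists2 v, V v & rnorm (x - v) < e.
Proof.
split=> [Vx e e0|h B /nbhs_normP[e /= e0 eB]].
  have [|v [Vv xv]] := Vx [set v | `|x - v| < e%:C].
    by apply/nbhs_normP; exists e%:C => //=; rewrite ltc0R.
  by exists v => //; move: xv; rewrite /= normr_rnorm ltcR.
have [e0' ee] := gt0c_real e0.
have [v Vv xv] := h _ e0'; exists v; split => //; apply: eB => /=.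
by rewrite ee normr_rnorm ltcR.
Qed.

Lemma rnorm_dense V x (e : R) :
  dense V -> 0 < e -> exists2 v, V v & rnorm (x - v) < e.
Proof.
move=> dV e0.
have [] := dV (ball x e%:C).
- by exists x; apply: ballxx; rewrite ltc0R.
- by apply: ball_open; rewrite ltc0R.
move=> v [+ Vv]; rewrite -ball_normE /= normr_rnorm ltcR => ?.
by exists v.
Qed.

(** The index of the approximating term can moreover be taken as large as
    wanted: a minimizing sequence is only known to be good far out. *)
Lemma rnorm_complete (v : nat -> H) :
  (forall e : R, 0 < e ->
     exists N, forall n, (N <= n)%N -> rnorm (v N - v n) < e) ->
  exists p, forall e : R, 0 < e ->
    exists n, rnorm (p - v n) < e /\ e * n.+1%:R > 1.
Proof.
move=> vC.
have /cauchy_cvg/cvg_ex[p vp] : cauchy (v @ \oo).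
  apply: cauchy_exP => e /gt0c_real[e0 ->].
  have [N vN] := vC _ e0; exists (v N); exists N => // n /= Nn.
  by rewrite -ball_normE /= normr_rnorm ltcR vN.
exists p => e e0.
have /(_ _ e%:C) := (cvgrPdist_lt _ _).1 vp.
rewrite ltc0R => /(_ e0)[N _ vN].
exists (maxn N (Num.truncn e^-1)).
split.
  have := vN (maxn N (Num.truncn e^-1)) => /(_ (leq_maxl _ _)).
  by rewrite normr_rnorm ltcR.
rewrite mulrC -ltr_pdivrMr// div1r; apply: (lt_le_trans (truncnS_gt _)).
by rewrite ler_nat ltnS leq_maxr.
Qed.

End Topology.

(** * Orthogonal projection *)

Section Projection.
Variables (R : realType) (H : hilbertType R).
Implicit Types (x y z w : H) (a : R[i]) (V A : set H).

Lemma subspaceP V : subspace_set V <->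
  V 0 /\ forall a x y, V x -> V y -> V (a *: x + y).
Proof.
split=> [[V0 VD]|[V0 VD]].
  split=> [|a x y Vx Vy]; first exact: set_mem.
  by apply/set_mem/VD; exact/mem_set.
split; first exact/mem_set.
by move=> a x y /set_mem Vx /set_mem Vy; apply/mem_set/VD.
Qed.

Lemma parallelogram x y :
  rnorm (x - y) ^+ 2 + rnorm (x + y) ^+ 2 =
  2 * rnorm x ^+ 2 + 2 * rnorm y ^+ 2.
Proof.
rewrite !sqr_rnormD rnormN.
have -> : inner x (- y) = - inner x y by rewrite linearNr.
by case: (inner x y) => r i /=; ring.
Qed.

(** First variation: |x - t v|^2 has its minimum over real t at 0, so its
    derivative -2 Re <x, v> there vanishes; replacing v by i v gives the
    imaginary part. *)
Lemma orth_of_minimal V x : subspace_set V ->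
  (forall v, V v -> rnorm x <= rnorm (x - v)) -> forall v, V v -> inner x v = 0.
Proof.
move=> /subspaceP[V0 VD] xmin.
have VZ a v : V v -> V (a *: v) by move=> Vv; rewrite -[_ *: _]addr0; exact: VD.
have re0 v : V v -> complex.Re (inner x v) = 0.
  move=> Vv; set r := complex.Re _.
  have key (t : R) : 2 * t * r <= t ^+ 2 * rnorm v ^+ 2.
    have := xmin _ (VZ t%:C _ Vv).
    rewrite -ler_sqr ?nnegrE ?rnorm_ge0// sqr_rnormD rnormN rnormZr exprMn.
    rewrite -scaleNr innerZr.
    have -> : complex.Re (Num.conj (- t%:C) * inner x v) = - t * r.
      by rewrite /r; case: (inner x v) => u w /=; ring.
    by rewrite real_normK ?num_real// -mulr_natr; lra.
  suff : r ^+ 2 <= 0 by rewrite real_exprn_even_le0 ?num_real// => /eqP.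
  have [n0|n0] := eqVneq (rnorm v) 0.
    by have := key r; rewrite n0 expr0n/= mulr0 -mulrA -expr2 pmulr_rle0.
  have n2 : 0 < rnorm v ^+ 2 by rewrite exprn_gt0// lt_def n0 rnorm_ge0.
  (* the minimizer of t^2 |v|^2 - 2 t r *)
  have := key (r / rnorm v ^+ 2).
  rewrite expr_div_n.
  have -> : r ^+ 2 / (rnorm v ^+ 2) ^+ 2 * rnorm v ^+ 2 = r ^+ 2 / rnorm v ^+ 2.
    by field.
  have -> : 2 * (r / rnorm v ^+ 2) * r = 2 * (r ^+ 2 / rnorm v ^+ 2).
    by field.
  move=> h; have {h} : r ^+ 2 / rnorm v ^+ 2 <= 0 by lra.
  by rewrite pmulr_lle0 ?invr_gt0.
move=> v Vv; have := re0 _ Vv; have := re0 _ (VZ 'i _ Vv).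
rewrite innerZr; case: (inner x v) => u w /= h ->; congr (_ +i* _).
by move: h; lra.
Qed.

(** A sequence in V minimizing the distance to x is Cauchy by the parallelogram
    law, and x - p inherits the minimality from it. For V closed, p lies in V;
    with the closure the result also covers spans that are not closed. *)
Lemma projection V x : subspace_set V ->
  exists2 p, closure V p & forall v, V v -> inner (x - p) v = 0.
Proof.
move=> sV; have /subspaceP[V0 VD] := sV.
pose D := [set rnorm (x - v) | v in V]; pose d := inf D.
have D0 : has_inf D.
  split; first by exists (rnorm (x - 0)); exists 0.
  by exists 0 => _ [v _ <-]; exact: rnorm_ge0.
have dV v : V v -> d <= rnorm (x - v).
  by move=> Vv; apply: ge_inf; [exact: D0.2|exists v].
have d0 : 0 <= d by apply: lb_le_inf D0.1 _ => _ [v _ <-]; exact: rnorm_ge0.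
have /choice[v_ vP] (n : nat) : exists v, V v /\ rnorm (x - v) < d + n.+1%:R^-1.
  have [||_ [v Vv <-] h] := @inf_adherent R D n.+1%:R^-1 => //.
  by exists v.
have cau e : 0 < e -> exists N, forall n, (N <= n)%N -> rnorm (v_ N - v_ n) < e.
  move=> e0; have K0 : 0 < 8 * d + 4 by lra.
  (* with distances below d + s and s <= 1, the parallelogram law bounds the
     squared gap by 4 (d + s)^2 - 4 d^2 <= (8 d + 4) s *)
  pose t := (8 * d + 4) / e ^+ 2.
  exists (Num.truncn t) => n Nn; set N := Num.truncn t in Nn *.
  pose s : R := N.+1%:R^-1.
  have s0 : 0 < s by rewrite invr_gt0.
  have s1 : s <= 1 by rewrite invf_le1// ler1n.
  have sn : n.+1%:R^-1 <= s by rewrite lef_pV2 ?posrE// ler_nat ltnS.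
  have se : (8 * d + 4) * s < e ^+ 2.
    have : t < N.+1%:R by exact: truncnS_gt.
    by rewrite /t /s !ltr_pdivrMr ?exprn_gt0// [_ * e ^+ 2]mulrC.
  have [VN dN] := vP N; have [Vn dn] := vP n.
  have := parallelogram (x - v_ N) (x - v_ n).
  have -> : x - v_ N - (x - v_ n) = - (v_ N - v_ n).
    by rewrite opprB addrC addrA subrK opprB.
  rewrite rnormN.
  have : 2 * d <= rnorm (x - v_ N + (x - v_ n)).
    have -> : x - v_ N + (x - v_ n) = 2%:R%:C *: (x - 2^-1%:C *: (v_ N + v_ n)).
      rewrite scalerBr scalerA -rmorphM/= divff ?pnatr_eq0// rmorph1 scale1r.
      by rewrite addrACA -opprD rmorph_nat scaler_nat mulr2n.
    rewrite rnormZr ger0_norm//.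
    rewrite ler_wpM2l//; apply: dV; rewrite scalerDr; apply: (VD) => //.
    by rewrite -[_ *: _]addr0; exact: VD.
  have {}dn := lt_le_trans dn (lerD (lexx d) sn).
  have e2 (E : R) : E ^+ 2 < e ^+ 2 -> E < e.
    apply: contraTT; rewrite -!leNgt => eE.
    by apply: lerXn2r; rewrite ?nnegrE ?(ltW e0)// (le_trans _ eE) ?ltW.
  move=> dC pE; apply: e2; move: dC pE.
  move: (rnorm_ge0 (x - v_ N)) (rnorm_ge0 (x - v_ n)) dN dn; rewrite -/s.
  move: (rnorm (x - v_ N)) (rnorm (x - v_ n)) (rnorm (v_ N - v_ n)).
  move: (rnorm (x - v_ N + (x - v_ n))) s s0 s1 se {sn}.
  move=> C s s0 s1 se A B E A0 B0 dA dB dC pE.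
  have hA : A ^+ 2 <= (d + s) ^+ 2 by rewrite ler_sqr ?nnegrE//; lra.
  have hB : B ^+ 2 <= (d + s) ^+ 2 by rewrite ler_sqr ?nnegrE//; lra.
  have hC : (2 * d) ^+ 2 <= C ^+ 2 by rewrite ler_sqr ?nnegrE; lra.
  nra.
have [p pP] := rnorm_complete cau.
have Vp : closure V p.
  apply/rnorm_closureP => e /pP[n [pn _]].
  by exists (v_ n) => //; exact: (vP n).1.
exists p => //; apply: orth_of_minimal => // v Vv; apply/ler_addgt0Pr => e e0.
have [|n [pn n1]] := pP (e / 3); first by lra.
have [Vn dn] := vP n.
have h1 : rnorm (x - p) <= rnorm (x - v_ n) + rnorm (p - v_ n).
  by rewrite (rnormB p) (le_trans _ (rnormD _ _))// addrA subrK.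
have h2 : d <= rnorm (x - p - v) + rnorm (p - v_ n).
  apply: le_trans (rnormD _ _).
  have -> : x - p - v + (p - v_ n) = x - (v + v_ n).
    by rewrite opprD !addrA (addrAC x (- p)) subrK.
  by apply: dV; rewrite -[v]scale1r; exact: VD.
have : n.+1%:R^-1 < e / 3.
  rewrite -ltf_pV2 ?posrE ?invr_gt0 ?divr_gt0// invrK -div1r.
  by rewrite ltr_pdivrMr ?divr_gt0// mulrC.
move: h1 h2 dn pn.
move: (rnorm _) (rnorm _) (rnorm _) (rnorm _) n.+1%:R^-1 => A B C D' s.
by move=> h1 h2 h3 h4 h5; lra.
Qed.

End Projection.

(** * Cauchy-Schwarz and the Riesz representation theorem *)

Section Riesz.
Variables (R : realType) (H : hilbertType R).

Lemma cauchy_schwarz (x y : H) : `|inner x y| <= (rnorm x * rnorm y)%:C.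
Proof.
have [->|y0] := eqVneq y 0; first by rewrite inner0r normr0 rnorm0 mulr0.
have ny : 0 < rnorm y.
  by rewrite lt_def rnorm_ge0 andbT; apply: contra_neq y0 => /rnorm_eq0.
pose b := inner x y; pose n2 := rnorm y ^+ 2.
have n20 : 0 < n2 by rewrite exprn_gt0.
have n2C : n2%:C != 0 by rewrite gt_eqF// ltc0R.
(* the squared norm of the component of x orthogonal to y *)
have h0 : 0 <= inner (x - (b / n2%:C) *: y) (x - (b / n2%:C) *: y).
  by rewrite rnorm_inner ler0c exprn_ge0 ?rnorm_ge0.
have nb : `|b| ^+ 2 = b * Num.conj b by rewrite normCK.
have h1 : inner (x - (b / n2%:C) *: y) (x - (b / n2%:C) *: y) =
    (rnorm x ^+ 2)%:C - `|b| ^+ 2 / n2%:C.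
  rewrite innerBl !innerBr !innerZl !innerZr (innerC y x) !rnorm_inner -/n2 -/b.
  have -> : Num.conj (b / n2%:C) = Num.conj b / n2%:C.
    rewrite rmorphM fmorphV; congr (_ / _).
    by apply/conj_Creal; rewrite complex_real.
  by rewrite nb; field.
have {h0 h1} : `|b| ^+ 2 <= ((rnorm x * rnorm y) ^+ 2)%:C.
  by move: h0; rewrite h1 subr_ge0 ler_pdivrMr ?ltc0R// -rmorphM/= -exprMn.
by rewrite rmorphXn/= ler_sqr// nnegrE ?normr_ge0// ler0c mulr_ge0 ?rnorm_ge0.
Qed.

Lemma inner_closure_span (A : set H) (z : H) :
  (forall x, A x -> inner x z = 0) ->
  forall x, closure (linear_span A) x -> inner x z = 0.
Proof.
move=> Az x /rnorm_closureP xA; apply: eq0_norm_le => e e0.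
have d0 : 0 < rnorm z + 1 by rewrite ltr_wpDl// rnorm_ge0.
have [s [n [c [a [Aa ->]]]] xs] := xA _ (divr_gt0 e0 d0).
set s' := \sum_(i < n) _ in xs.
have sz : inner s' z = 0.
  rewrite linear_sumlz big1// => i _.
  by rewrite -[LHS]/(inner (c i *: a i) z) innerZl Az ?mulr0.
have -> : inner x z = inner (x - s') z by rewrite innerBl sz subr0.
rewrite (le_trans (cauchy_schwarz _ _))// lecR.
rewrite (le_trans (ler_wpM2r (rnorm_ge0 z) (ltW xs)))//.
rewrite mulrAC ler_pdivrMr// ler_pM2l//.
by rewrite lerDl.
Qed.

(** If f is not zero, its kernel is a closed hyperplane, and f is the inner
    product with a suitable multiple of a vector w orthogonal to it, because
    (f w) x - (f x) w lies in the kernel and so is orthogonal to w. *)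
Lemma riesz_representation (f : H -> R[i]) (C : R) :
  (forall a x y, f (a *: x + y) = a * f x + f y) ->
  (forall x, `|f x| <= (C * rnorm x)%:C) ->
  exists z, forall x, f x = inner x z.
Proof.
move=> fD fC.
have f0 : f 0 = 0.
  by have := fD (-1) 0 0; rewrite scaler0 addr0 mulN1r addNr.
have fZ a x : f (a *: x) = a * f x by rewrite -[a *: x]addr0 fD f0 addr0.
have fB x y : f (x - y) = f x - f y by rewrite -scaleN1r addrC fD mulN1r addrC.
have [fz|/existsNP[u fu]] := pselect (forall x, f x = 0).
  by exists 0 => x; rewrite inner0r.
pose N := [set x | f x = 0].
have sN : subspace_set N.
  apply/subspaceP; split=> // a x y fx fy.
  by rewrite /N/= fD fx fy mulr0 addr0.
have cN x : closure N x -> N x.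
  move=> /rnorm_closureP xN; apply: eq0_norm_le => e e0.
  have d0 : 0 < `|C| + 1 by rewrite ltr_wpDl// normr_ge0.
  have [v fv xv] := xN _ (divr_gt0 e0 d0).
  have -> : f x = f (x - v) by rewrite fB fv subr0.
  rewrite (le_trans (fC _))// lecR.
  rewrite (le_trans (ler_wpM2r (rnorm_ge0 _) (ler_norm C)))//.
  rewrite (le_trans (ler_wpM2l (normr_ge0 _) (ltW xv)))//.
  by rewrite mulrCA ler_piMr ?(ltW e0)// ler_pdivrMr// mul1r lerDl.
have [p /cN Np up] := projection u sN.
pose w := u - p.
have fw : f w = f u by rewrite fB Np subr0.
have w0 : inner w w != 0.
  rewrite rnorm_inner; apply/eqP => /complexI/eqP.
  rewrite sqrf_eq0 => /eqP/rnorm_eq0 w0.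
  by apply: fu; rewrite -fw w0.
exists (Num.conj (f w / inner w w) *: w) => x.
rewrite innerZr conjCK.
have : inner (f w *: x - f x *: w) w = 0.
  rewrite innerC up ?rmorph0// /N/= fB !fZ; ring.
rewrite innerBl !innerZl => /eqP; rewrite subr_eq0 => /eqP h.
by rewrite mulrAC h mulfK.
Qed.

End Riesz.

(** * Bounded operators, adjoints and Hilbert tensor products *)

Section Adjoint.
Variables (R : realType).
Implicit Types (H K L : hilbertType R).

Definition bounded_by H K (f : H -> K) (C : R) :=
  forall x, rnorm (f x) <= C * rnorm x.

Lemma bounded_linearP H K (f : H -> K) :
  bounded_linear f <-> linear f /\ exists2 C, 0 <= C & bounded_by f C.
Proof.
split=> [[lf bf]|[lf [C C0 fC]]]; split => //.
  pose fl := GRing.isLinear.Build _ _ _ _ f lf.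
  pose F : {linear H -> K} := HB.pack f fl.
  have /linear_boundedP/pinfty_ex_gt0[M M0 FM] : bounded_near F (nbhs (0 : H)).
    by [].
  have [M0' ME] := gt0c_real M0.
  exists (complex.Re M); first exact: ltW.
  by move=> x; rewrite -lecR rmorphM/= -!normr_rnorm -ME; exact: FM.
apply/ex_bound; exists C%:C.
apply/nbhs_norm0P; exists 1 => //= x /= x1.
rewrite normr_rnorm lecR (le_trans (fC x))// ler_piMr//.
by rewrite -lecR -normr_rnorm ltW.
Qed.

Lemma bounded_linear_comp H K L (f : K -> L) (g : H -> K) :
  bounded_linear f -> bounded_linear g -> bounded_linear (f \o g).
Proof.
move=> /bounded_linearP[lf [C C0 fC]] /bounded_linearP[lg [D D0 gD]].
apply/bounded_linearP; split; first by move=> a x y /=; rewrite lg lf.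
exists (C * D); first exact: mulr_ge0.
by move=> x /=; rewrite (le_trans (fC _))// -mulrA ler_wpM2l.
Qed.

(** Existence of the adjoint: x |-> <f x, y> is a bounded functional. *)
Lemma inner_adjointr H K (f : H -> K) : bounded_linear f ->
  forall x y, inner (f x) y = inner x (adjoint f y).
Proof.
move=> /bounded_linearP[lf [C C0 fC]] x y.
pose g u := inner (f u) y.
have [||z zP] := @riesz_representation _ H g (C * rnorm y).
- by move=> a u v; rewrite /g lf innerDl innerZl.
- move=> u; rewrite /g (le_trans (cauchy_schwarz _ _))// lecR.
  by rewrite mulrAC ler_wpM2r ?rnorm_ge0.
apply: (@xgetPex _ 0 [set z | forall x, inner (f x) y = inner x z]).
by exists z.
Qed.

Lemma inner_adjointl H K (f : H -> K) : bounded_linear f ->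
  forall x y, inner (adjoint f y) x = inner y (f x).
Proof. by move=> bf x y; rewrite innerC -inner_adjointr// -innerC. Qed.

Lemma inner_ext H (x y : H) : (forall z, inner z x = inner z y) -> x = y.
Proof.
move=> h; apply/eqP; rewrite -subr_eq0; apply/eqP/inner_nondeg => z.
by rewrite innerBr h subrr.
Qed.

Lemma subset_linear_span H (A : set H) : A `<=` linear_span A.
Proof.
move=> x Ax; exists 1%N, (fun=> 1), (fun=> x); split => //.
by rewrite big_ord1 scale1r.
Qed.

Lemma linear_span_subspace H (A : set H) : subspace_set (linear_span A).
Proof.
apply/subspaceP; split.
  exists 0%N, (fun=> 0), (fun=> 0); split; first by case.
  by rewrite big_ord0.
move=> a x y [n [c [u [Au ->]]]] [m [d [v [Av ->]]]].
exists (n + m)%N, (fun i : 'I_(n + m) =>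
  match fintype.split i with inl j => a * c j | inr j => d j end).
exists (fun i : 'I_(n + m) =>
  match fintype.split i with inl j => u j | inr j => v j end); split.
  by move=> i; case: (fintype.split i).
rewrite big_split_ord /= scaler_sumr; congr (_ + _); apply: eq_bigr => i _.
  by rewrite (unsplitK (inl _)) scalerA.
by rewrite (unsplitK (inr _)).
Qed.

(** Inner product with a fixed vector is continuous, so orthogonality to it
    passes to the closure. *)
Lemma orthocomplement_closed H (A : set H) :
  closed_subspace (orthocomplement A).
Proof.
split.
  apply/subspaceP; split; first by move=> y _; rewrite inner0l.
  by move=> a x y xA yA z Az; rewrite innerDl innerZl xA// yA// mulr0 addr0.
move=> x xA y Ay; apply: (@inner_closure_span _ _ (orthocomplement A)).
  by move=> u uA; exact: uA.
exact: closure_subset (@subset_linear_span _ _) _ xA.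
Qed.

Lemma orthogonal_decompositionP H (V : set H) :
  closed_subspace V -> orthogonal_decomposition V (orthocomplement V).
Proof.
move=> cV; have [sV clV] := cV; split => //.
- exact: orthocomplement_closed.
- by move=> v w Vv Vw; rewrite innerC Vw ?rmorph0.
move=> x; have [p Vp xp] := projection x sV.
exists p, (x - p); split => //; last by rewrite addrC subrK.
by rewrite ((closure_id V).1 clV).
Qed.

Lemma rnorm_tensor H K (T : hilbertTensor H K) u v :
  rnorm (tensor T u v) = rnorm u * rnorm v.
Proof.
apply/eqP; rewrite -(@eqrXn2 _ 2)// ?mulr_ge0 ?rnorm_ge0//.
apply/eqP/complexI.
by rewrite -rnorm_inner inner_tensor !rnorm_inner exprMn [in RHS]rmorphM.
Qed.

Lemma bounded_linear_tensorr H K (T : hilbertTensor H K) u :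
  bounded_linear (tensor T u).
Proof.
apply/bounded_linearP; split.
  by move=> a x y; rewrite linearDr linearZr_LR.
exists (rnorm u); first exact: rnorm_ge0.
by move=> v; rewrite rnorm_tensor.
Qed.

Lemma tensor_total H K (T : hilbertTensor H K) (z : T) :
  (forall u v, inner (tensor T u v) z = 0) -> z = 0.
Proof.
move=> zT; apply: inner_nondeg => y.
apply: (@inner_closure_span _ _ [set tensor T p.1 p.2 | p in setT]).
  by move=> _ [p _ <-].
apply/rnorm_closureP => e e0; apply: rnorm_dense => //; exact: dense_tensor.
Qed.

(** Subtract from t its projection p on the tensor square of V. The difference
    is orthogonal to the tensors v (x) v' by construction, and to w (x) x and
    x (x) w since both t and p are; as H = W + V these tensors span the whole
    space, so t = p. *)
Lemma tensor_subspace_orth H (T : hilbertTensor H H) (V W : set H) (t : T) :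
  orthogonal_decomposition W V ->
  (forall w x, W w -> inner (tensor T w x) t = 0) ->
  (forall x w, W w -> inner (tensor T x w) t = 0) ->
  tensor_subspace T V V t.
Proof.
move=> [_ _ WV dec] tl tr.
pose A := [set tensor T p.1 p.2 | p in V `*` V].
have [p pA tp] := projection t (linear_span_subspace A).
suff -> : t = p by [].
apply/eqP; rewrite -subr_eq0; apply/eqP/tensor_total => x y.
have pl w z : W w -> inner (tensor T w z) p = 0.
  move=> Ww; rewrite innerC (inner_closure_span _ pA) ?rmorph0//.
  move=> _ [[u v] [Vu _] <-].
  by rewrite inner_tensor (innerC u) (WV w u)// rmorph0 mul0r.
have pr z w : W w -> inner (tensor T z w) p = 0.
  move=> Ww; rewrite innerC (inner_closure_span _ pA) ?rmorph0//.
  move=> _ [[u v] [_ Vv] <-].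
  by rewrite inner_tensor (innerC v) (WV w v)// rmorph0 mulr0.
have [w [v [Ww Vv ->]]] := dec x; have [w' [v' [Ww' Vv' ->]]] := dec y.
rewrite [tensor T (w + v) _]linearDl [tensor T v _]linearDr !innerDl !innerBr.
rewrite tl// pl// tr// pr// !subrr !add0r -innerBr innerC.
rewrite tp ?rmorph0//; apply: subset_linear_span.
by exists (v, v').
Qed.

Lemma tensor_ext H K (T : hilbertTensor H K) (z z' : T) :
  (forall u v, inner (tensor T u v) z = inner (tensor T u v) z') -> z = z'.
Proof.
move=> h; apply/eqP; rewrite -subr_eq0; apply/eqP/tensor_total => u v.
by rewrite innerBr h subrr.
Qed.

End Adjoint.

(** * Modular ideals and the Jacobson radical *)

Section Ideals.
Variables (R : realType) (H : hilbertType R) (HH : hilbertTensor H H).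
Variable mu : HH -> H.
Local Notation "x ** y" := (product mu x y) (at level 40).
Hypothesis mu_bounded : bounded_linear mu.
Hypothesis assoc : associative (product mu).
Hypothesis comm : commutative (product mu).

Lemma product_bounded x : bounded_linear (product mu x).
Proof. exact: bounded_linear_comp mu_bounded (bounded_linear_tensorr HH x). Qed.

Lemma productPr x a y z : x ** (a *: y + z) = a *: (x ** y) + x ** z.
Proof. by have [lin _] := product_bounded x; rewrite lin. Qed.

Lemma productDr x y z : x ** (y + z) = x ** y + x ** z.
Proof. by rewrite -[y]scale1r productPr !scale1r. Qed.

Lemma product0r x : x ** 0 = 0.
Proof. by apply: (addrI (x ** 0)); rewrite -productDr !addr0. Qed.

Lemma productZr x a y : x ** (a *: y) = a *: (x ** y).
Proof. by rewrite -[a *: y]addr0 productPr product0r addr0. Qed.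

Lemma productDl x y z : (y + z) ** x = y ** x + z ** x.
Proof. by rewrite !(comm _ x) productDr. Qed.

Lemma productZl x a y : (a *: y) ** x = a *: (y ** x).
Proof. by rewrite !(comm _ x) productZr. Qed.

Lemma productBr x y z : x ** (y - z) = x ** y - x ** z.
Proof. by rewrite productDr -scaleN1r productZr scaleN1r. Qed.

Lemma jacobson_ideal : is_ideal mu (jacobson_radical mu).
Proof.
split.
  apply/subspaceP; split=> [I [[/subspaceP[I0 _] _] _ _ _] //|a x y xJ yJ I mI].
  have [[/subspaceP[_ ID] _] _ _ _] := mI.
  by apply: ID; [exact: xJ|exact: yJ].
by move=> x y xJ I mI; have [[_ IM] _ _ _] := mI; apply: IM; exact: xJ.
Qed.

Lemma ideal_setT (I : set H) e : is_ideal mu I ->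
  (forall h, I (h - e ** h)) -> I e -> I = setT.
Proof.
move=> [/subspaceP[_ ID] IM] Ie eI; apply/seteqP; split => // h _.
rewrite -[h](subrK (e ** h)) -[_ - _]scale1r.
by apply: ID; [exact: Ie|exact: IM].
Qed.

(** A chain of ideals that avoid e has a union that avoids e, and an ideal with
    e as modular identity is proper exactly when it avoids e
    ([ideal_setT]). *)
Lemma modular_maximal (I : set H) e : is_ideal mu I ->
  (forall h, I (h - e ** h)) -> ~ I e ->
  exists M, [/\ maximal_modular mu M, I `<=` M & ~ M e].
Proof.
move=> idI modI nIe.
(* Adjoining I makes the union of the empty chain admissible. *)
pose P X := is_ideal mu (I `|` X) /\ ~ (I `|` X) e.
have [F FP Ftot|X [[idX nXe] Xmax]] := @Zorn_bigcup H P.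
  pose G := I `|` \bigcup_(X in F) X.
  have common x y : G x -> G y -> exists X,
      [/\ P X, I `|` X `<=` G, (I `|` X) x & (I `|` X) y].
    have P0 : P set0 by rewrite /P setU0.
    have sub X : F X -> I `|` X `<=` G.
      by move=> FX; apply: setUS; exact: bigcup_sup.
    move=> [Ix|[X FX Xx]] [Iy|[Y FY Yy]].
    - by exists set0; split; [|apply: setUS; exact: sub0set|left|left].
    - by exists Y; split; [exact: FP|exact: sub|left|right].
    - by exists X; split; [exact: FP|exact: sub|right|left].
    - have [XY|YX] := Ftot _ _ FX FY.
        by exists Y; split; [exact: FP|exact: sub|right; exact: XY|right].
      by exists X; split; [exact: FP|exact: sub|right|right; exact: YX].
  split; last first.
    by move=> Ge; have [X [[_ nXe] _ Xe _]] := common _ _ Ge Ge.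
  split.
    apply/subspaceP; split; first by left; case: idI => /subspaceP[].
    move=> a x y Gx Gy.
    have [X [[[/subspaceP[_ XD] _] _] XG Xx Xy]] := common _ _ Gx Gy.
    by apply: XG; exact: XD.
  move=> x y Gx; have [X [[[_ XM] _] XG Xx _]] := common _ _ Gx Gx.
  by apply: XG; exact: XM.
exists (I `|` X); split; [|exact: subsetUl|exact: nXe].
split => //.
- by exists e => h; left; exact: modI.
- by move=> XT; apply: nXe; rewrite XT.
move=> K idK XK KT.
have IK : I `<=` K by apply: subset_trans XK; exact: subsetUl.
have nKe : ~ K e.
  by move=> Ke; apply: KT; apply: (ideal_setT idK _ Ke) => h; apply: IK.
have PK : P K by rewrite /P (setUidr IK).
apply/seteqP; split => //; apply: contrapT => nKX.
apply: (Xmax K) => //; split; first by apply: subset_trans XK; exact: subsetUr.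
by move=> KX; apply: nKX; apply: subset_trans KX _; exact: subsetUr.
Qed.

(** The elements h - e h form an ideal with modular identity e. If it missed e,
    it would lie in a maximal modular ideal M that misses e; but e e is in M by
    hypothesis and e - e e by construction. *)
Lemma jacobson_quasi_inverse e :
  (forall h, jacobson_radical mu (e ** h)) -> exists y, y - e ** y = e.
Proof.
move=> eJ; pose I := [set h - e ** h | h in setT].
suff [y _ ye] : I e by exists y.
apply: contrapT => nIe.
have idI : is_ideal mu I.
  split.
    apply/subspaceP; split; first by exists 0 => //; rewrite product0r subr0.
    move=> a _ _ [x _ <-] [y _ <-]; exists (a *: x + y) => //.
    by rewrite productPr opprD addrACA scalerBr.
  move=> _ y [x _ <-]; exists (x ** y) => //.
  by rewrite assoc comm (comm (_ ** _)) (comm (x - _)) productBr !(comm y).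
have [|M [mM IM nMe]] := @modular_maximal I e idI _ nIe.
  by move=> h; exists h.
have [[/subspaceP[_ MD] _] _ _ _] := mM.
apply: nMe; rewrite -[e](subrK (e ** e)) -[_ - _]scale1r; apply: MD.
  by apply: IM; exists e.
exact: eJ.
Qed.

Lemma annihilator_jacobson : annihilator mu `<=` jacobson_radical mu.
Proof.
move=> u uA I [_ [e eI] _ _].
by have := eI u; rewrite comm uA subr0.
Qed.

End Ideals.

(** * The Frobenius identity *)

Lemma unitary_inverse_bounded (R : realType) (H K : hilbertType R)
    (f : H -> K) (g : K -> H) :
  unitary_map f -> cancel f g -> cancel g f -> bounded_linear g.
Proof.
move=> [lf fI _] fK gK; apply/bounded_linearP; split.
  by move=> a x y; apply: (can_inj fK); rewrite gK lf !gK.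
exists 1 => // x; rewrite mul1r -{2}(gK x) le_eqVlt; apply/orP; left.
rewrite -(@eqrXn2 _ 2)// ?rnorm_ge0//.
by apply/eqP/complexI; rewrite -!rnorm_inner fI.
Qed.

(** Pair mu^dagger (mu (x (x) y)) with a (x) b. Directly this is <x y, a b>,
    that is <y, L_x (a b)>. Through the other side of the identity it is the
    value of t |-> <(M_x (x) id) t, a (x) b> at t = mu^dagger y; on elementary
    tensors, hence everywhere, this functional is t |-> <t, (L_x a) (x) b>, so
    the value is <y, (L_x a) b>. *)
Lemma frobenius_adjoint_product (R : realType) (H : hilbertType R)
    (HH : hilbertTensor H H) (HH_H : hilbertTensor HH H)
    (H_HH : hilbertTensor H HH) (mu : HH -> H) :
  frobenius_semigroup mu HH_H H_HH -> forall x a b,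
  product mu (adjoint (product mu x) a) b =
  adjoint (product mu x) (product mu a b).
Proof.
move=> [[mub _ _] [alpha [alphaV [mu_id [id_mu [comu_id [id_comu]]]]]]].
move=> [[[ua alphaE] aK aVK] [tensor_maps [frob _]]] x a b.
have [[mu_idb mu_idE] _ _ [_ id_comuE]] := tensor_maps.
have bx := product_bounded mub x.
pose f := mu_id \o (alphaV \o tensor H_HH x).
have fb : bounded_linear f.
  apply: bounded_linear_comp mu_idb _.
  apply: bounded_linear_comp (bounded_linear_tensorr H_HH x).
  exact: unitary_inverse_bounded ua aK aVK.
have fE : adjoint f (tensor HH a b) = tensor HH (adjoint (product mu x) a) b.
  apply: tensor_ext => u v; rewrite -inner_adjointr// /f /= -alphaE aK mu_idE.
  by rewrite !inner_tensor -(inner_adjointr bx).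
apply: inner_ext => y; rewrite -(inner_adjointr bx).
have := congr1 (fun h => inner (h (tensor HH x y)) (tensor HH a b)) frob.
rewrite /= id_comuE (inner_adjointl mub) => <-.
rewrite -[mu_id _]/(f (adjoint mu y)) (inner_adjointr fb) fE.
by rewrite (inner_adjointl mub).
Qed.

(** * The radical, the annihilator and its orthocomplement *)

Section Frobenius.
Variables (R : realType) (H : hilbertType R) (HH : hilbertTensor H H).
Variable mu : HH -> H.
Local Notation "x ** y" := (product mu x y) (at level 40).
Local Notation L x := (adjoint (product mu x)).
Hypothesis mu_bounded : bounded_linear mu.
Hypothesis assoc : associative (product mu).
Hypothesis comm : commutative (product mu).
Hypothesis frob : forall x a b, L x a ** b = L x (a ** b).

Let mul_bounded := product_bounded mu_bounded.

(** M_x is normal. *)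
Lemma rnorm_adjoint_product x h : rnorm (L x h) = rnorm (x ** h).
Proof.
apply/eqP; rewrite -(@eqrXn2 _ 2)// ?rnorm_ge0//.
apply/eqP/complexI; rewrite -!rnorm_inner (inner_adjointl (mul_bounded x)).
by rewrite comm frob comm -(inner_adjointr (mul_bounded x)).
Qed.

(** If x were in J without annihilating H, then for z = L_x x the positive
    operator M_z would have its norm c > 0 in its approximate spectrum, although
    z / c has a quasi-inverse and so I - M_z / c is bounded below. *)
Lemma jacobson_annihilator : jacobson_radical mu `<=` annihilator mu.
Proof.
move=> x xJ h0.
pose S := [set c : R | 0 <= c /\
  forall h, rnorm (x ** h) ^+ 2 <= c * rnorm h ^+ 2].
have S0 : S !=set0.
  have /bounded_linearP[_ [C C0 xC]] := mul_bounded x.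
  exists (C ^+ 2); split; first exact: exprn_ge0.
  by move=> h; rewrite -exprMn lerXn2r ?nnegrE ?mulr_ge0 ?rnorm_ge0.
have Slb : lbound S 0 by move=> c [].
pose c := inf S.
have c0 : 0 <= c by exact: lb_le_inf.
have Sc h : rnorm (x ** h) ^+ 2 <= c * rnorm h ^+ 2.
  have [->|nh] := eqVneq h 0.
    by rewrite (product0r mu_bounded) rnorm0 expr0n mulr0.
  have hp : 0 < rnorm h ^+ 2.
    rewrite exprn_gt0// lt_def rnorm_ge0 andbT.
    by apply: contra_neq nh => /rnorm_eq0.
  rewrite -ler_pdivrMr//; apply: lb_le_inf => // d [_ dS].
  by rewrite ler_pdivrMr.
have [c00|nc] := eqVneq c 0.
  apply: rnorm_eq0; apply/eqP; rewrite -sqrf_eq0 eq_le sqr_ge0 andbT.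
  by have := Sc h0; rewrite c00 mul0r.
have {nc} cp : 0 < c by rewrite lt_def nc.
pose z := L x x; pose e := c^-1%:C *: z.
have zE h : z ** h = L x (x ** h) by rewrite /z frob.
have zE' h : z ** h = x ** L x h by rewrite zE [RHS]comm frob comm.
have eE h : e ** h = c^-1%:C *: (z ** h) by rewrite productZl.
have [y ye] : exists y, y - e ** y = e.
  apply: (jacobson_quasi_inverse mu_bounded assoc comm) => h.
  have [sJ MJ] := jacobson_ideal mu; move/subspaceP: sJ => [J0 JD].
  by rewrite eE -[_ *: _]addr0; apply: JD => //; rewrite zE'; exact: MJ.
have /bounded_linearP[_ [C C0 yC]] := mul_bounded y.
pose D := (1 + C) ^+ 2.
have D1 : 1 <= D by rewrite /D expr_ge1 ?lerDl// addr_ge0.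
(* I + M_y is a left inverse of I - M_e. *)
have inv h : h = (h - e ** h) + y ** (h - e ** h).
  rewrite productBr// assoc -{1}[y](subrK (e ** y)) ye.
  by rewrite productDl// (comm y e) addrK subrK.
have hD h : rnorm h ^+ 2 <= D * rnorm (h - e ** h) ^+ 2.
  rewrite -exprMn lerXn2r ?nnegrE ?mulr_ge0 ?addr_ge0 ?rnorm_ge0//.
  by rewrite {1}(inv h) (le_trans (rnormD _ _))// mulrDl mul1r lerD2l yC.
have gE h :
    rnorm (h - e ** h) ^+ 2 <= rnorm h ^+ 2 - c^-1 * rnorm (x ** h) ^+ 2.
  rewrite sqr_rnormD rnormN eE.
  have -> : complex.Re (inner h (- (c^-1%:C *: (z ** h)))) =
      - (c^-1 * rnorm (x ** h) ^+ 2).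
    rewrite -scaleNr -rmorphN/= innerZr zE -inner_adjointr// rnorm_inner.
    by rewrite /=; ring.
  rewrite rnormZr exprMn real_normK ?num_real//.
  rewrite zE rnorm_adjoint_product.
  have : c^-1 ^+ 2 * rnorm (x ** (x ** h)) ^+ 2 <= c^-1 * rnorm (x ** h) ^+ 2.
    by rewrite expr2 -mulrA ler_wpM2l ?invr_ge0// ler_pdivrMl.
  lra.
(* An admissible constant smaller than c. *)
have : S (c * (1 - D^-1)).
  split; first by rewrite mulr_ge0// subr_ge0 invf_le1// (lt_le_trans ltr01).
  move=> h; have := le_trans (hD h) (ler_wpM2l (le_trans ler01 D1) (gE h)).
  have Dp : 0 < D by rewrite (lt_le_trans ltr01).
  rewrite -ler_pdivrMl// => hh.
  rewrite -mulrA -ler_pdivrMl//; lra.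
move=> /(ge_inf (ex_intro _ _ Slb)); rewrite -/c.
rewrite ler_pMr// lerBrDl gerDr leNgt invr_gt0 (lt_le_trans ltr01)//.
Qed.

(** <u v, w> = <u, L_v w>. This form gives that the annihilator is closed. *)
Lemma annihilator_orth :
  annihilator mu = orthocomplement [set L p.1 p.2 | p in setT].
Proof.
apply/seteqP; split=> u.
  move=> uA _ [[v w] _ <-] /=.
  by rewrite -inner_adjointr// comm uA inner0l.
move=> uO v; rewrite comm; apply: inner_ext => w.
rewrite inner0r innerC inner_adjointr// uO ?rmorph0//.
by exists (v, w).
Qed.

Lemma product_perp x y : orthocomplement (annihilator mu) (x ** y).
Proof.
move=> a aA; rewrite inner_adjointr//.
suff -> : L x a = 0 by rewrite inner0r.
by apply: rnorm_eq0; rewrite rnorm_adjoint_product comm aA rnorm0.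
Qed.

Lemma adjoint_mu_annihilator a : annihilator mu a -> adjoint mu a = 0.
Proof.
move=> aA; apply: (@tensor_total _ _ _ HH) => u v.
by rewrite -(inner_adjointr mu_bounded); exact: (product_perp _ _ aA).
Qed.

(** <mu t, b> = <t, mu^dagger b> depends continuously on t, so it is enough to
    look at elementary tensors. *)
Lemma subalgebra_orthocomplement (V B : set H) :
  V = orthocomplement B ->
  (forall u v, V u -> V v -> V (u ** v)) -> subalgebra mu V.
Proof.
move=> -> VM; split; first exact: orthocomplement_closed.
move=> _ [t tV <-] b Bb; rewrite inner_adjointr//.
apply: inner_closure_span tV => _ [[u v] [Vu Vv] <-] /=.
by rewrite -inner_adjointr//; apply: VM.
Qed.

End Frobenius.

Theorem theorem30 (R : realType) (H : hilbertType R)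
    (HH : hilbertTensor H H) (HH_H : hilbertTensor HH H)
    (H_HH : hilbertTensor H HH) (mu : HH -> H) :
  frobenius_semigroup mu HH_H H_HH ->
  let J := jacobson_radical mu in
  let Jperp := orthocomplement J in
  [/\ orthogonal_decomposition J Jperp,
      subalgebra mu Jperp /\ subcoalgebra mu Jperp,
      J = annihilator mu,
      subalgebra mu J /\ subcoalgebra mu J
    & is_ideal mu J /\ is_ideal mu Jperp].
Proof.
move=> mu_frob J Jperp.
have [[mu_bounded assoc comm] _] := mu_frob.
have frob := frobenius_adjoint_product mu_frob.
have JA : J = annihilator mu.
  apply/seteqP; split; last exact: annihilator_jacobson.
  exact: jacobson_annihilator.
have JO := annihilator_orth mu_bounded comm; rewrite -JA in JO.
have cJ : closed_subspace J by rewrite JO; exact: orthocomplement_closed.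
have cJperp : closed_subspace Jperp := orthocomplement_closed J.
have dec : orthogonal_decomposition J Jperp := orthogonal_decompositionP cJ.
have Jperp_product x y : Jperp (product mu x y).
  by rewrite /Jperp JA; exact: product_perp.
have Jcomu a : J a -> adjoint mu a = 0.
  by rewrite JA; exact: adjoint_mu_annihilator.
split => //.
- split; first exact: (subalgebra_orthocomplement mu_bounded (erefl Jperp)).
  split => // _ [z zJ <-].
  have Jmul w x : J w -> product mu w x = 0 by rewrite JA; exact.
  apply: (tensor_subspace_orth dec) => [w x|x w] Jw;
    rewrite -inner_adjointr// -/(product mu _ _) ?(comm x) Jmul ?inner0l//.
- split.
    apply: (subalgebra_orthocomplement mu_bounded JO) => u v Ju _.
    exact: (jacobson_ideal mu).2.
  split => // _ [a Ja <-]; rewrite Jcomu//; apply: subset_closure.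
  pose A := [set tensor HH p.1 p.2 | p in J `*` J].
  by have /subspaceP[] := linear_span_subspace A.
- by split; [exact: jacobson_ideal|split=> [|x y _]; [exact: cJperp.1|]].
Qed.
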